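(* Let $((F,\nu,N),[\cdot,\cdot]_{F,h},(\rho,\eta))$ be a generalized Lie algebroid, let $L$ be a Lagrange fundamental function on the vector bundle $(E,\pi,M)$ and let $H$ be its Legendre transformation. If the vector bundle morphism $((\rho,\eta)T\varphi_H,\varphi_H)$ from $(\rho,\eta)TE^*$ to $(\rho,\eta)TE$ is a morphism of Lie algebroids, then, for all values of the free indices: $$(L^\gamma_{\alpha\beta}\circ h\circ\overset{*}{\pi})\circ\varphi_L=L^\gamma_{\alpha\beta}\circ h\circ\pi,$$ $$\begin{aligned}\big(((L^\gamma_{\alpha\beta}\rho^k_\gamma)\circ h\circ\overset{*}{\pi})\,H_k^b\big)\circ\varphi_L={}&(\rho^i_\alpha\circ h\circ\pi)\tfrac{\partial}{\partial x^i}\big(((\rho^j_\beta\circ h\circ\overset{*}{\pi})H_j^b)\circ\varphi_L\big)-(\rho^j_\beta\circ h\circ\pi)\tfrac{\partial}{\partial x^j}\big(((\rho^i_\alpha\circ h\circ\overset{*}{\pi})H_i^b)\circ\varphi_L\big)\\&+\big(((\rho^i_\alpha\circ h\circ\overset{*}{\pi})H_i^c)\circ\varphi_L\big)\tfrac{\partial}{\partial y^c}\big(((\rho^j_\beta\circ h\circ\overset{*}{\pi})H_j^b)\circ\varphi_L\big)\\&-\big(((\rho^j_\beta\circ h\circ\overset{*}{\pi})H_j^c)\circ\varphi_L\big)\tfrac{\partial}{\partial y^c}\big(((\rho^i_\alpha\circ h\circ\overset{*}{\pi})H_i^b)\circ\varphi_L\big),\end{aligned}$$ $$\begin{aligned}0={}&(\rho^i_\alpha\circ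 h\circ\pi)\tfrac{\partial}{\partial x^i}(H^{ba}\circ\varphi_L)+\big(((\rho^i_\alpha\circ h\circ\overset{*}{\pi})H_i^c)\circ\varphi_L\big)\tfrac{\partial}{\partial y^c}(H^{ba}\circ\varphi_L)\\&-(H^{bc}\circ\varphi_L)\tfrac{\partial}{\partial y^c}\big(((\rho^i_\alpha\circ h\circ\overset{*}{\pi})H_i^a)\circ\varphi_L\big),\end{aligned}$$ $$0=(H^{ac}\circ\varphi_L)\tfrac{\partial}{\partial y^c}(H^{bd}\circ\varphi_L)-(H^{bc}\circ\varphi_L)\tfrac{\partial}{\partial y^c}(H^{ad}\circ\varphi_L).$$
   Context: Repeated indices are summed. $M,N$ are $m$-dimensional manifolds, $h:M\to N$, $\eta:N\to M$ diffeomorphisms; a generalized Lie algebroid consists of a vector bundle $(F,\nu,N)$, a vector bundle morphism $(\rho,\eta)$ from $(F,\nu,N)$ to $(TM,\tau_M,M)$ with local components $\rho^i_\alpha$ (functions on $N$), and a Lie bracket on $\Gamma(F,\nu,N)$ satisfying $[z,fw]_{F,h}=f[z,w]_{F,h}+(\Gamma(Th\circ\rho,h\circ\eta)(z)f)w$, where $\Gamma(Th\circ\rho,h\circ\eta)(z^\alpha t_\alpha)(f)=z^\alpha\rho_\alpha^i\big(\tfrac{\partial(f\circ h)}{\partial x^i}\circ h^{-1}\big)$, $(t_\alpha)$ a local frame of $F$, and $[t_\alpha,t_\beta]_{F,h}=L^\gamma_{\alpha\beta}t_\gamma$. $(E,\pi,M)$ has rank $r$, local frame $(s_a)$, coordinates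 $(x^i,y^a)$, vector fields $\partial_i=\partial/\partial x^i$, $\dot\partial_a=\partial/\partial y^a$; its dual $(E^*,\overset{*}{\pi},M)$ has dual frame $(s^a)$, coordinates $(x^i,p_a)$, vector fields $\overset{*}{\partial}_i$, $\dot\partial^a$. $(\rho,\eta)TE\subset(h\circ\pi)^*F\oplus TE$ is the vector bundle over $E$ with local frame $\tilde\partial_\alpha=T_\alpha\oplus(\rho^i_\alpha\circ h\circ\pi)\partial_i$, $\dot{\tilde\partial}_a=0\oplus\dot\partial_a$ ($T_\alpha$ induced by $t_\alpha$). It is a Lie algebroid with anchor $X^\alpha\tilde\partial_\alpha+\tilde X^a\dot{\tilde\partial}_a\mapsto X^\alpha(\rho_\alpha^i\circ h\circ\pi)\partial_i+\tilde X^a\dot\partial_a$ and bracket determined by $[\tilde\partial_\alpha,\tilde\partial_\beta]=(L^\gamma_{\alpha\beta}\circ h\circ\pi)\tilde\partial_\gamma$, $[\tilde\partial_\alpha,\dot{\tilde\partial}_b]=0=[\dot{\tilde\partial}_a,\dot{\tilde\partial}_b]$ and the Leibniz rule. Likewise $(\rho,\eta)TE^*\subset(h\circ\overset{*}{\pi})^*F\oplus TE^*$ has frame $\overset{*}{\tilde\partial}_\alpha=\overset{*}{T}_\alpha\oplus(\rho^i_\alpha\circ h\circ\overset{*}{\pi})\overset{*}{\partial}_i$, $\dot{\tilde\partial}{}^a=0\oplus\dot\partial^a$, anchor $X^\alpha\overset{*}{\tilde\partial}_\alpha+\tilde X_a\dot{\tilde\partial}{}^a\mapsto X^\alpha(\rho_\alpha^i\circ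 h\circ\overset{*}{\pi})\overset{*}{\partial}_i+\tilde X_a\dot\partial^a$, and brackets $[\overset{*}{\tilde\partial}_\alpha,\overset{*}{\tilde\partial}_\beta]=(L^\gamma_{\alpha\beta}\circ h\circ\overset{*}{\pi})\overset{*}{\tilde\partial}_\gamma$, all other brackets of frame elements zero. A Lagrange fundamental function is $L:E\to\mathbb R$ with $L\circ u\in C^\infty(M)$ for every nonzero section $u$ and $L\circ0\in C^0(M)$; a Hamilton fundamental function $H:E^*\to\mathbb R$ is defined by the same conditions on $E^*$. The derivatives $L_{ab}=\partial^2L/\partial y^a\partial y^b$, $H^{ab}=\partial^2H/\partial p_a\partial p_b$, $H_i^b=\partial^2H/\partial x^i\partial p_b$ are taken to exist (and be smooth off the zero section). Legendre morphisms: $\varphi_L:E\to E^*$, $u^as_a(x)\mapsto u^aL_{ab}(u_x)s^b(x)$; $\varphi_H:E^*\to E$, $u_as^a(x)\mapsto u_aH^{ab}(\overset{*}{u}_x)s_b(x)$. The Legendre transformation of $L$ is the Hamilton fundamental function given locally by $H(\overset{*}{u}_x)=u_au^a-L(u_x)$ for $\overset{*}{u}_x=u_as^a(x)$, where $u_x=u^as_a(x)$ solves $u_b=u^aL_{ab}(u_x)$, $b=1,\dots,r$. The morphism $((\rho,\eta)T\varphi_H,\varphi_H)$ acts on sections additively by $$\Gamma((\rho,\eta)T\varphi_H,\varphi_H)(Z^\alpha\overset{*}{\tilde\partial}_\alpha)=(Z^\alpha\circ\varphi_L)\tilde\partial_\alpha+\big([(\rho^i_\alpha\circ h\circ\overset{*}{\pi})Z^\alpha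 H_i^b]\circ\varphi_L\big)\dot{\tilde\partial}_b,$$ $$\Gamma((\rho,\eta)T\varphi_H,\varphi_H)(Y_a\dot{\tilde\partial}{}^a)=\big((Y_aH^{ab})\circ\varphi_L\big)\dot{\tilde\partial}_b.$$ It is a morphism of Lie algebroids when this map on sections preserves brackets. All identities are understood where the functions involved are defined. *)

(* Defs.v *)
From HB Require Import structures.
From mathcomp Require Import all_boot all_order all_algebra.
From mathcomp Require Import ring.
From mathcomp Require Import all_classical all_reals all_analysis.

Set Implicit Arguments.
Unset Strict Implicit.
Unset Printing Implicit Defensive.
Import Order.TTheory GRing.Theory Num.Theory.
Import numFieldNormedType.Exports.
Local Open Scope classical_set_scope.
Local Open Scope ring_scope.

(** * Smooth functions between normed spaces *)

(* Iterated directional derivative. *)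
Definition iter_dir (R : realType) (V W : normedModType R) (f : V -> W)
  (ds : seq V) : V -> W := foldr (fun v g => 'D_v g) f ds.

(* C^oo on a neighbourhood of q0; in finite dimension, all iterated directional
   derivatives being differentiable is equivalent to the usual condition on
   iterated partial derivatives. *)
Definition smooth_at (R : realType) (V W : normedModType R) (f : V -> W)
  (q0 : V) : Prop :=
  \forall q \near q0, forall ds : seq V, differentiable (iter_dir f ds) q.

(** * Manifolds *)

(* [cinv] is only meaningful on the (open) range [cmap @` cdom]. *)
Record chart (R : realType) (T : topologicalType) (m : nat) := Chart {
  cdom : set T ;
  cmap : T -> 'rV[R]_m ;
  cinv : 'rV[R]_m -> T }.

Definition is_chart (R : realType) (T : topologicalType) (m : nat)
    (c : chart R T m) : Prop :=
  [/\ open (cdom c), open (cmap c @` cdom c),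
      (forall x, cdom c x -> cinv c (cmap c x) = x),
      (forall x, cdom c x -> {for x, continuous (cmap c)}) &
      (forall q, (cmap c @` cdom c) q -> {for q, continuous (cinv c)})].

Record manifold (R : realType) (m : nat) := Manifold {
  mcar :> topologicalType ;
  atlas : set (chart R mcar m) ;
  mfd_hausdorff : hausdorff_space mcar ;
  mfd_second_countable : @second_countable mcar ;
  mfd_chart : forall c, atlas c -> is_chart c ;
  mfd_cover : forall x : mcar, exists2 c, atlas c & cdom c x ;
  mfd_compat : forall c c', atlas c -> atlas c' ->
    forall x, cdom c x -> cdom c' x ->
      smooth_at (cmap c' \o cinv c) (cmap c x) }.

Arguments atlas {R m} M : rename.

Definition msmooth_at (R : realType) (m : nat) (M : manifold R m)
    (f : M -> R) (x : M) : Prop :=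
  forall c, atlas M c -> cdom c x -> smooth_at (f \o cinv c : _ -> R^o) (cmap c x).

Definition smooth_map (R : realType) (m : nat) (M N : manifold R m)
    (h : M -> N) : Prop :=
  continuous h /\
  forall c d, atlas M c -> atlas N d -> forall x, cdom c x -> cdom d (h x) ->
    smooth_at (cmap d \o h \o cinv c) (cmap c x).

Record diffeo (R : realType) (m : nat) (M N : manifold R m) := Diffeo {
  dfun :> M -> N ;
  dinv : N -> M ;
  dfunK : cancel dfun dinv ;
  dinvK : cancel dinv dfun ;
  dfun_smooth : smooth_map dfun ;
  dinv_smooth : smooth_map dinv }.

(* Tangent vectors at x: families of components, one for each chart around x,
   related by the Jacobians of the changes of charts ('J acts on row vectors
   from the right); the values of [tcomp] at other charts are irrelevant. *)
Record tangent (R : realType) (m : nat) (M : manifold R m) (x : M) := Tangent {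
  tcomp : chart R M m -> 'rV[R]_m ;
  tcomp_change : forall c c', atlas M c -> atlas M c' -> cdom c x -> cdom c' x ->
    tcomp c' = tcomp c *m 'J (cmap c' \o cinv c) (cmap c x) }.

(** * Vector bundles *)

Record frame (R : realType) (T : Type) (E : T -> vectType R) (r : nat) :=
  Frame { fdom : set T ; fvec : forall x, r.-tuple (E x) }.

(* A smooth vector bundle, given by its fibres and by a family of local frames
   over an open cover whose change-of-frame coefficients are smooth; this is
   the same as a family of local trivializations with smooth transitions. *)
Record vbundle (R : realType) (m : nat) (M : manifold R m) (r : nat) :=
  VBundle {
  fiber :> M -> vectType R ;
  frames : set (frame fiber r) ;
  frame_open : forall s, frames s -> open (fdom s) ;
  frame_basis : forall s, frames s -> forall x, fdom s x ->
    basis_of fullv (fvec s x) ;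
  frame_cover : forall x : M, exists2 s, frames s & fdom s x ;
  frame_compat : forall s s', frames s -> frames s' ->
    forall x, fdom s x -> fdom s' x -> forall a b,
      msmooth_at (fun y => coord (fvec s y) b (tnth (fvec s' y) a)) x }.

Arguments frames {R m M r} E : rename.

Definition smooth_section (R : realType) (m : nat) (M : manifold R m)
    (r : nat) (E : vbundle M r) (z : forall x, E x) : Prop :=
  forall s, frames E s -> forall x, fdom s x -> forall a,
    msmooth_at (fun y => coord (fvec s y) a (z y)) x.

(** * The dual bundle *)

Definition dual_fiber (R : realType) (T : Type) (E : T -> vectType R) (x : T)
  : vectType R := 'Hom(E x, R^o).

Definition dual_frame (R : realType) (T : Type) (E : T -> vectType R) (r : nat)
    (s : frame E r) : frame (dual_fiber E) r :=
  Frame (fdom s) (fun x => [tuple (linfun (coord (fvec s x) a)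
                                   : dual_fiber E x) | a < r]).


Lemma differentiable_near_eq (R : realType) (V W : normedModType R)
    (f g : V -> W) (q : V) :
  (\forall z \near q, f z = g z) -> differentiable f q -> differentiable g q.
Proof.
move=> fg df; have fgq : f q = g q by exact: nbhs_singleton fg.
have [dfc fE] := (diff_locallyP q f).1 df.
have gE : g \o shift q = cst (g q) + 'd f q +o_ 0 id.
  move/eqaddoP: fE => fE; apply/eqaddoP => e e0.
  have fg0 : \forall h \near 0, f (h + q) = g (h + q).
    by move: fg; rewrite [X in X -> _](near_shift 0)/= subr0.
  have := fE e e0; apply: filter_app; near=> h.
  by rewrite /= !fctE /= -fgq (near fg0 h).
have dE := diff_unique dfc gE.
by apply/diff_locallyP; rewrite dE.
Unshelve. all: by end_near. Qed.

Lemma smooth_at_near_eq (R : realType) (V W : normedModType R)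
    (f g : V -> W) (q : V) :
  (\forall z \near q, f z = g z) -> smooth_at f q -> smooth_at g q.
Proof.
rewrite /smooth_at => fg.
have iterE ds (z : V) : (\forall y \near z, f y = g y) ->
    \forall y \near z, iter_dir f ds y = iter_dir g ds y.
  elim: ds z => [//|v ds IH] z fgz; have := near_join fgz.
  by apply: filterS => y /IH; exact: near_eq_derive.
move=> sf; have := near_join fg; move: sf.
apply: filterS2 => z sf fz ds.
exact: differentiable_near_eq (iterE ds z fz) (sf ds).
Qed.

Lemma msmooth_at_near_eq (R : realType) (m : nat) (M : manifold R m)
    (f g : M -> R) (x : M) :
  (\forall y \near x, f y = g y) -> msmooth_at f x -> msmooth_at g x.
Proof.
move=> fg sf c cA cx; have [_ _ cK _ cinvC] := mfd_chart cA.
apply: smooth_at_near_eq (sf c cA cx).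
have /cinvC : (cmap c @` cdom c) (cmap c x) by exists x.
by move/(_ [set y | f y = g y]); apply; rewrite cK.
Qed.

Section DualBasis.
Context (R : realType) (V : vectType R) (r : nat) (X : r.-tuple V).
Hypothesis Xb : basis_of fullv X.

Let Y : r.-tuple 'Hom(V, R^o) := [tuple linfun (coord X a) | a < r].

Lemma dual_coordE (w : 'Hom(V, R^o)) :
  w = \sum_(a < r) w (tnth X a) *: tnth Y a.
Proof.
apply/lfunP => v; rewrite sum_lfunE [in LHS](coord_basis Xb (memvf v)).
rewrite linear_sum; apply: eq_bigr => a _.
rewrite linearZ !lfunE/= tnth_mktuple lfunE/= -tnth_nth.
by rewrite [LHS]mulrC.
Qed.

Lemma dual_basis_of : basis_of fullv Y.
Proof.
apply/andP; split.
  rewrite eqEsubv subvf /=; apply/subvP => w _; rewrite (dual_coordE w).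
  apply: memv_suml => a _; apply: memvZ; apply: memv_span; exact: mem_tnth.
have YE (j i : 'I_r) : Y`_j X`_i = (i == j)%:R.
  by rewrite -tnth_nth tnth_mktuple lfunE/= coord_free// (basis_free Xb).
apply/freeP => k /lfunP k0 i; have := k0 X`_i.
rewrite sum_lfunE (bigD1 i)//= big1 => [|j ji].
  by rewrite addr0 scale_lfunE YE eqxx lfunE/= [LHS]mulr1.
by rewrite scale_lfunE YE eq_sym (negbTE ji) scaler0.
Qed.

Lemma coord_dual (w : 'Hom(V, R^o)) b : coord Y b w = w (tnth X b).
Proof.
have {1}-> : w = \sum_(a < r) w (tnth X a) *: Y`_a.
  rewrite [LHS]dual_coordE; apply: eq_bigr => a _.
  by rewrite [in LHS](tnth_nth 0 Y).
exact: (coord_sum_free (fun a => w (tnth X a)) b (basis_free dual_basis_of)).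
Qed.

End DualBasis.

Section Dual.
Context (R : realType) (m : nat) (M : manifold R m) (r : nat).
Context (E : vbundle M r).

Let dframes : set (frame (dual_fiber E) r) := [set dual_frame s | s in frames E].

Fact dual_open s : dframes s -> open (fdom s).
Proof. by case=> s' s'E <-; exact: frame_open. Qed.

Fact dual_basis s : dframes s -> forall x, fdom s x ->
  basis_of fullv (fvec s x).
Proof. by case=> s' s'E <- x s'x; apply/dual_basis_of/frame_basis. Qed.

Fact dual_cover (x : M) : exists2 s, dframes s & fdom s x.
Proof.
by have [s sE sx] := frame_cover E x; exists (dual_frame s) => //; exists s.
Qed.

Fact dual_compat s s' : dframes s -> dframes s' ->
  forall x, fdom s x -> fdom s' x -> forall a b,
    msmooth_at (fun y => coord (fvec s y) b (tnth (fvec s' y) a)) x.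
Proof.
case=> [s0 sE <-] [s1 s'E <-] x /= sx s'x a b.
apply: msmooth_at_near_eq (frame_compat s'E sE s'x sx b a).
have /open_nbhs_nbhs : open_nbhs x (fdom s0).
  by split=> //; exact: frame_open.
apply: filterS => y sy; rewrite (coord_dual (frame_basis sE sy)).
by rewrite tnth_mktuple lfunE.
Qed.

Definition dual_bundle : vbundle M r :=
  VBundle dual_open dual_basis dual_cover dual_compat.

End Dual.

(** * Generalized Lie algebroids *)

(* A bundle F over N with a bundle morphism (rho, eta) to TM and a Lie bracket
   on its smooth sections.  The Leibniz rule is written in coordinates: at k,
   the anchor acts on f by
     (z^al rho^i_al)(k) * d(f o h)/dx^i (h^-1 k),
   where the components of rho are those of a tangent vector at eta k; hence
   the chart has to contain both eta k and h^-1 k. *)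
Record gen_lie_algebroid (R : realType) (m : nat) (M N : manifold R m)
    (h : diffeo M N) (eta : diffeo N M) (p : nat) := GenLieAlgebroid {
  gla_bundle :> vbundle N p ;
  gla_rho : forall k : N, gla_bundle k -> tangent (eta k) ;
  gla_rho_linear : forall k (a : R) (z w : gla_bundle k) c,
    atlas M c -> cdom c (eta k) ->
    tcomp (gla_rho (a *: z + w)) c =
    a *: tcomp (gla_rho z) c + tcomp (gla_rho w) c ;
  gla_rho_smooth : forall t c, frames gla_bundle t -> atlas M c ->
    forall k, fdom t k -> cdom c (eta k) -> forall al i,
    msmooth_at (fun k' => tcomp (gla_rho (tnth (fvec t k') al)) c ord0 i) k ;
  gla_brk : (forall k, gla_bundle k) -> (forall k, gla_bundle k) ->
            (forall k, gla_bundle k) ;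
  gla_brk_smooth : forall z w, smooth_section z -> smooth_section w ->
    smooth_section (gla_brk z w) ;
  gla_brk_linear : forall (a : R) z z' w,
    smooth_section z -> smooth_section z' -> smooth_section w ->
    forall k, gla_brk (fun x => a *: z x + z' x) w k =
              a *: gla_brk z w k + gla_brk z' w k ;
  gla_brk_anti : forall z w, smooth_section z -> smooth_section w ->
    forall k, gla_brk z w k = - gla_brk w z k ;
  gla_brk_jacobi : forall z w v,
    smooth_section z -> smooth_section w -> smooth_section v ->
    forall k, gla_brk z (gla_brk w v) k + gla_brk w (gla_brk v z) k
              + gla_brk v (gla_brk z w) k = 0 ;
  gla_brk_leibniz : forall z w (f : N -> R),
    smooth_section z -> smooth_section w -> (forall k, msmooth_at f k) ->
    forall c k, atlas M c -> cdom c (eta k) -> cdom c (dinv h k) ->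
    gla_brk z (fun x => f x *: w x) k =
    f k *: gla_brk z w k +
    (\sum_(i < m) tcomp (gla_rho (z k)) c ord0 i *
       'D_(delta_mx ord0 i) (f \o h \o cinv c : _ -> R^o) (cmap c (dinv h k)))
      *: w k }.

Section LocalComponents.
Context (R : realType) (m p : nat) (M N : manifold R m).
Context (h : diffeo M N) (eta : diffeo N M).
Variable A : gen_lie_algebroid h eta p.

(* rho^i_al *)
Definition rho_comp (c : chart R M m) (t : frame A p) (i : 'I_m) (al : 'I_p)
  : N -> R := fun k => tcomp (gla_rho (tnth (fvec t k) al)) c ord0 i.

(* [t_al, t_be] = L^ga_{al be} t_ga on the domain of the frame; the bracket of
   local sections is that of global sections which extend them locally. *)
Definition structure_functions (t : frame A p)
    (Ls : 'I_p -> 'I_p -> 'I_p -> N -> R) : Prop :=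
  forall (W : set N) z w al be, open W -> W `<=` fdom t ->
    smooth_section z -> smooth_section w ->
    (forall k, W k -> z k = tnth (fvec t k) al) ->
    (forall k, W k -> w k = tnth (fvec t k) be) ->
    forall k, W k -> gla_brk z w k =
      \sum_(ga < p) Ls al be ga k *: tnth (fvec t k) ga.

End LocalComponents.

(** * Calculus on the total space of a bundle *)

Definition tot (R : realType) (T : Type) (E : T -> vectType R) : Type :=
  {x : T & E x}.

Section TotalSpace.
Context (R : realType) (T : topologicalType) (m r : nat) (E : T -> vectType R).
Variables (c : chart R T m) (s : frame E r).

(* The coordinates (x^i, y^a) defined by the chart c and the frame s. *)
Definition fcoord (a : 'I_r) (u : tot E) : R :=
  coord (fvec s (tag u)) a (tagged u).

Definition to_coord (u : tot E) : 'rV[R]_m * 'rV[R]_r :=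
  (cmap c (tag u), \row_a fcoord a u).

Definition of_coord (q : 'rV[R]_m * 'rV[R]_r) : tot E :=
  existT (fun x => E x) (cinv c q.1)
    (\sum_(a < r) q.2 ord0 a *: tnth (fvec s (cinv c q.1)) a).

Definition local_rep (f : tot E -> R) : 'rV[R]_m * 'rV[R]_r -> R^o :=
  fun q => f (of_coord q).

Definition tsmooth_at (f : tot E -> R) (u : tot E) : Prop :=
  smooth_at (local_rep f) (to_coord u).

Definition xdir (i : 'I_m) : 'rV[R]_m * 'rV[R]_r := (delta_mx ord0 i, 0).
Definition ydir (a : 'I_r) : 'rV[R]_m * 'rV[R]_r := (0, delta_mx ord0 a).

Definition pd (d : 'rV[R]_m * 'rV[R]_r) (f : tot E -> R) (u : tot E) : R :=
  'D_d (local_rep f) (to_coord u).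

(* The coordinate vector fields d/dx^i and d/dy^a of the total space. *)
Definition dx (i : 'I_m) : (tot E -> R) -> tot E -> R := pd (xdir i).
Definition dy (a : 'I_r) : (tot E -> R) -> tot E -> R := pd (ydir a).

(* pd d1 (pd d2 f) exists and is smooth near u. *)
Definition smooth_pd2_at (d1 d2 : 'rV[R]_m * 'rV[R]_r) (f : tot E -> R)
    (u : tot E) : Prop :=
  (\forall q \near to_coord u, derivable (local_rep f) q d2 /\
                               derivable (local_rep (pd d2 f)) q d1) /\
  tsmooth_at (pd d1 (pd d2 f)) u.

End TotalSpace.

Lemma to_coordK (R : realType) (T : topologicalType) (m r : nat)
    (E : T -> vectType R) (c : chart R T m) (s : frame E r) (u : tot E) :
  is_chart c -> cdom c (tag u) -> basis_of fullv (fvec s (tag u)) ->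
  of_coord c s (to_coord c s u) = u.
Proof.
case: u => x e /= [_ _ cK _ _] cx sx; rewrite /of_coord /= cK//.
rewrite [e in RHS](coord_basis sx (memvf e)); congr existT.
by apply: eq_bigr => a _; rewrite mxE /fcoord -tnth_nth.
Qed.

(** * Lagrange and Hamilton fundamental functions *)

Section Fundamental.
Context (R : realType) (m : nat) (M : manifold R m) (r : nat).
Variable E : vbundle M r.

Definition along (f : tot E -> R) (z : forall x, E x) : M -> R :=
  fun x => f (existT (fun x => E x) x (z x)).

(* A Lagrange fundamental function on E; a Hamilton fundamental function is a
   fundamental function on [dual_bundle E].  "Nonzero section" is read as
   "nowhere vanishing section". *)
Definition fundamental (f : tot E -> R) : Prop :=
  (forall z : (forall x, E x), smooth_section z -> (forall x, z x != 0) ->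
     forall x, msmooth_at (along f z) x) /\
  continuous (along f (fun x => 0) : M -> R^o).

(* d^2 f / dy^a dy^b exist, and are smooth, off the zero section. *)
Definition regular_yy (f : tot E -> R) : Prop :=
  forall c s, atlas M c -> frames E s -> forall u : tot E,
    cdom c (tag u) -> fdom s (tag u) -> tagged u != 0 ->
    forall a b : 'I_r, smooth_pd2_at c s (ydir R m a) (ydir R m b) f u.

(* d^2 f / dx^i dy^b exist, and are smooth, off the zero section. *)
Definition regular_xy (f : tot E -> R) : Prop :=
  forall c s, atlas M c -> frames E s -> forall u : tot E,
    cdom c (tag u) -> fdom s (tag u) -> tagged u != 0 ->
    forall (i : 'I_m) (b : 'I_r),
      smooth_pd2_at c s (xdir R r i) (ydir R m b) f u.

End Fundamental.

Section Legendre.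
Context (R : realType) (m : nat) (M : manifold R m) (r : nat).
Variable E : vbundle M r.
Variables (c : chart R M m) (s : frame E r).

(* phi_L : u^a s_a(x) |-> u^a L_ab(u_x) s^b(x) *)
Definition legendre_map (L : tot E -> R) (u : tot E) : tot (dual_bundle E) :=
  existT (fun x => dual_bundle E x) (tag u)
    (\sum_(b < r) (\sum_(a < r) fcoord s a u * dy c s a (dy c s b L) u) *:
       (tnth (fvec (dual_frame s) (tag u)) b : dual_bundle E (tag u))).

End Legendre.

(* H(w) = w_a u^a - L(u) for every solution u of w_b = u^a L_ab(u), b < r,
   in the fibre of w; solvability is part of the definition of H. *)
Definition legendre_transform (R : realType) (m : nat) (M : manifold R m)
    (r : nat) (E : vbundle M r) (L : tot E -> R) (H : tot (dual_bundle E) -> R)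
  : Prop :=
  forall c s, atlas M c -> frames E s -> forall w : tot (dual_bundle E),
    cdom c (tag w) -> fdom s (tag w) ->
    let emb (v : E (tag w)) : tot E := existT (fun x => E x) (tag w) v in
    let solves (v : E (tag w)) := forall b, fcoord (dual_frame s) b w =
      \sum_(a < r) fcoord s a (emb v) * dy c s a (dy c s b L) (emb v) in
    (exists v, solves v) /\
    forall v, solves v ->
      H w = \sum_(a < r) fcoord (dual_frame s) a w * fcoord s a (emb v)
            - L (emb v).

(** * The Lie algebroids (rho, eta)TE and (rho, eta)TE* *)

(* A local section X^al D_al + X^a V_a in the frame
     D_al = T_al (+) (rho^i_al o h o pi) d/dx^i,   V_a = 0 (+) d/dy^a,
   given by its components; E is either the given bundle or its dual. *)
Record psection (R : realType) (T : Type) (E : T -> vectType R) (p r : nat) :=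
  PSection { hor : 'I_p -> tot E -> R ; ver : 'I_r -> tot E -> R }.

Section Prolongation.
Context (R : realType) (m p r : nat) (M N : manifold R m).
Context (h : diffeo M N) (eta : diffeo N M).
Variables (A : gen_lie_algebroid h eta p) (E : vbundle M r).
Variables (c : chart R M m) (s : frame E r) (t : frame A p).
Variable Ls : 'I_p -> 'I_p -> 'I_p -> N -> R.

(* The points over which all the local components are defined. *)
Definition pdom (x : M) : Prop :=
  [/\ cdom c x, fdom s x, fdom t (h x) & cdom c (eta (h x))].

Definition smooth_psection (X : psection E p r) : Prop :=
  forall u : tot E, pdom (tag u) ->
    (forall al, tsmooth_at c s (hor X al) u) /\
    (forall a, tsmooth_at c s (ver X a) u).

Definition panchor (X : psection E p r) (f : tot E -> R) : tot E -> R :=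
  fun u =>
    \sum_(al < p) hor X al u *
      (\sum_(i < m) rho_comp c t i al (h (tag u)) * dx c s i f u)
    + \sum_(a < r) ver X a u * dy c s a f u.

(* The bracket determined by the brackets of the frame and the Leibniz rule:
   see the lemmas pbrk_hh, pbrk_hv, pbrk_vv, pbrk_anti and pbrk_leibniz. *)
Definition pbrk (X Y : psection E p r) : psection E p r := PSection
  (fun ga u =>
     \sum_(al < p) \sum_(be < p)
        hor X al u * hor Y be u * Ls al be ga (h (tag u))
     + panchor X (hor Y ga) u - panchor Y (hor X ga) u)
  (fun a u => panchor X (ver Y a) u - panchor Y (ver X a) u).

Definition hframe (al : 'I_p) : psection E p r :=
  PSection (fun be _ => (be == al)%:R) (fun _ _ => 0).
Definition vframe (a : 'I_r) : psection E p r :=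
  PSection (fun _ _ => 0) (fun b _ => (b == a)%:R).

Definition pscale (f : tot E -> R) (X : psection E p r) : psection E p r :=
  PSection (fun al u => f u * hor X al u) (fun a u => f u * ver X a u).

Let panchor_cst X (k : R) u : panchor X (fun=> k) u = 0.
Proof.
have pd_cst d : pd c s d (fun=> k) u = 0 by exact: derive_cst.
rewrite /panchor !big1 ?addr0// => [a _|al _]; first by rewrite /dy pd_cst mulr0.
by rewrite big1 ?mulr0// => i _; rewrite /dx pd_cst mulr0.
Qed.

Lemma pbrk_hh al be u :
  (forall ga, hor (pbrk (hframe al) (hframe be)) ga u
              = Ls al be ga (h (tag u))) /\
  (forall a, ver (pbrk (hframe al) (hframe be)) a u = 0).
Proof.
split=> [ga|a]; rewrite /= !panchor_cst subr0 ?addr0//.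
rewrite (bigD1 al)//= [X in _ + X]big1 => [|i ia]; last first.
  by rewrite big1 => // j _; rewrite (negbTE ia) !mul0r.
rewrite addr0 (bigD1 be)//= big1 => [|j jb].
  by rewrite !eqxx !mul1r addr0.
by rewrite (negbTE jb) mulr0 mul0r.
Qed.

Lemma pbrk_hv al b u :
  (forall ga, hor (pbrk (hframe al) (vframe b)) ga u = 0) /\
  (forall a, ver (pbrk (hframe al) (vframe b)) a u = 0).
Proof.
split=> ?; rewrite /= !panchor_cst subr0 ?addr0//.
by rewrite big1 => // i _; rewrite big1 => // j _; rewrite mulr0 mul0r.
Qed.

Lemma pbrk_vv a b u :
  (forall ga, hor (pbrk (vframe a) (vframe b)) ga u = 0) /\
  (forall d, ver (pbrk (vframe a) (vframe b)) d u = 0).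
Proof.
split=> ?; rewrite /= !panchor_cst subr0 ?addr0//.
by rewrite big1 => // i _; rewrite big1 => // j _; rewrite mulr0 mul0r.
Qed.

Lemma pbrk_anti X Y u :
  (forall al be ga, Ls al be ga (h (tag u)) = - Ls be al ga (h (tag u))) ->
  (forall ga, hor (pbrk X Y) ga u = - hor (pbrk Y X) ga u) /\
  (forall a, ver (pbrk X Y) a u = - ver (pbrk Y X) a u).
Proof.
move=> La; split=> [ga|a] /=; last by ring.
suff -> : \sum_(al < p) \sum_(be < p)
            hor X al u * hor Y be u * Ls al be ga (h (tag u)) =
          - \sum_(al < p) \sum_(be < p)
            hor Y al u * hor X be u * Ls al be ga (h (tag u)) by ring.
rewrite exchange_big -sumrN; apply: eq_bigr => be _ /=.
rewrite -sumrN; apply: eq_bigr => al _.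
by rewrite La; ring.
Qed.

Lemma pbrk_leibniz X Y f u :
  of_coord c s (to_coord c s u) = u ->
  (forall d, derivable (local_rep c s f) (to_coord c s u) d) ->
  (forall al d, derivable (local_rep c s (hor Y al)) (to_coord c s u) d) ->
  (forall a d, derivable (local_rep c s (ver Y a)) (to_coord c s u) d) ->
  (forall ga, hor (pbrk X (pscale f Y)) ga u
     = f u * hor (pbrk X Y) ga u + panchor X f u * hor Y ga u) /\
  (forall a, ver (pbrk X (pscale f Y)) a u
     = f u * ver (pbrk X Y) a u + panchor X f u * ver Y a u).
Proof.
move=> uK df dh dv.
have pdM g d : (forall d', derivable (local_rep c s g) (to_coord c s u) d') ->
    pd c s d (fun v => f v * g v) u = f u * pd c s d g u + pd c s d f u * g u.
  move=> dg; rewrite /pd.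
  have := deriveM (df d) (dg d).
  rewrite /GRing.scale/= /local_rep uK => e.
  by rewrite [LHS]e; ring.
have panchorM g : (forall d, derivable (local_rep c s g) (to_coord c s u) d) ->
    panchor X (fun v => f v * g v) u = f u * panchor X g u + panchor X f u * g u.
  move=> dg; rewrite /panchor [f u * _]mulrDr mulrDl.
  rewrite [RHS]addrACA; congr (_ + _).
    rewrite mulr_sumr mulr_suml -big_split; apply: eq_bigr => al _ /=.
    have e (i : 'I_m) (k : R) : k * dx c s i (fun v => f v * g v) u =
        f u * (k * dx c s i g u) + k * dx c s i f u * g u.
      by rewrite /dx pdM//; ring.
    under eq_bigr do rewrite e.
    by rewrite big_split/= -mulr_sumr -mulr_suml; ring.
  rewrite mulr_sumr mulr_suml -big_split; apply: eq_bigr => a _ /=.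
  by rewrite /dy pdM//; ring.
have panchorZ g : panchor (pscale f Y) g u = f u * panchor Y g u.
  rewrite /panchor mulrDr !mulr_sumr; congr (_ + _).
    by apply: eq_bigr => al _; rewrite /= mulrA.
  by apply: eq_bigr => a _; rewrite /= mulrA.
split=> [ga|a] /=; rewrite panchorM// panchorZ; last by ring.
suff -> : \sum_(al < p) \sum_(be < p)
            hor X al u * (f u * hor Y be u) * Ls al be ga (h (tag u)) =
          f u * \sum_(al < p) \sum_(be < p)
            hor X al u * hor Y be u * Ls al be ga (h (tag u)) by ring.
rewrite mulr_sumr; apply: eq_bigr => al _.
by rewrite mulr_sumr; apply: eq_bigr => be _; ring.
Qed.

End Prolongation.

Section Morphism.
Context (R : realType) (m p r : nat) (M N : manifold R m).
Context (h : diffeo M N) (eta : diffeo N M).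
Variables (A : gen_lie_algebroid h eta p) (E : vbundle M r).
Variables (c : chart R M m) (s : frame E r) (t : frame A p).
Variable Ls : 'I_p -> 'I_p -> 'I_p -> N -> R.
Variables (L : tot E -> R) (H : tot (dual_bundle E) -> R).

Let s' : frame (dual_bundle E) r := dual_frame s.
Let phiL : tot E -> tot (dual_bundle E) := legendre_map c s L.

(* The action of ((rho, eta)T phi_H, phi_H) on sections. *)
Definition Gamma_TphiH (X : psection (dual_bundle E) p r)
  : psection E p r := PSection
  (fun al u => hor X al (phiL u))
  (fun b u =>
     \sum_(al < p) \sum_(i < m)
        rho_comp c t i al (h (tag (phiL u))) * hor X al (phiL u) *
        dx c s' i (dy c s' b H) (phiL u)
     + \sum_(a < r) ver X a (phiL u) * dy c s' a (dy c s' b H) (phiL u)).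

(* The points of E where the functions occurring in [Gamma_TphiH], and in the
   brackets of its values, are defined. *)
Definition mdom (u : tot E) : Prop :=
  [/\ pdom c s t (tag u),
      (forall a b, smooth_pd2_at c s (ydir R m a) (ydir R m b) L u),
      (forall a b, smooth_pd2_at c s' (ydir R m a) (ydir R m b) H (phiL u)) &
      (forall i b, smooth_pd2_at c s' (xdir R r i) (ydir R m b) H (phiL u))].

Lemma mdom_off_zero (u : tot E) : atlas M c -> frames E s ->
  regular_yy L -> regular_yy H -> regular_xy H ->
  pdom c s t (tag u) -> tagged u != 0 -> tagged (phiL u) != 0 -> mdom u.
Proof.
move=> cM sE rL rH rH' ud u0 v0; have [cu su _ _] := ud.
have s'E : frames (dual_bundle E) s' by exists s.
by split=> // *; [apply: rL|apply: rH|apply: rH'].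
Qed.

(* Preservation of brackets by the action on sections, over the domain of the
   chart c and the frames s, t. *)
Definition lie_algebroid_morphism : Prop :=
  forall X Y : psection (dual_bundle E) p r,
    smooth_psection c s' t X -> smooth_psection c s' t Y ->
    let lhs := Gamma_TphiH (pbrk c s' t Ls X Y) in
    let rhs := pbrk c s t Ls (Gamma_TphiH X) (Gamma_TphiH Y) in
    forall u, mdom u ->
      (forall ga, hor lhs ga u = hor rhs ga u) /\
      (forall b, ver lhs b u = ver rhs b u).

End Morphism.

(* Main.v *)
Require Import Defs.
From HB Require Import structures.
From mathcomp Require Import all_boot all_order all_algebra.
From mathcomp Require Import all_classical all_reals all_analysis.

Set Implicit Arguments.
Unset Strict Implicit.
Unset Printing Implicit Defensive.
Import Order.TTheory GRing.Theory Num.Theory.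
Import numFieldNormedType.Exports.
Local Open Scope classical_set_scope.
Local Open Scope ring_scope.

(** A map that preserves brackets preserves in particular the brackets of the
    frame sections.  These are admissible test sections, since their components
    are constant, hence smooth, and each identity other than the first is a
    vertical component of one such equation.

    The morphism sends the horizontal frame section of index al to the section
    with horizontal part of index al and vertical components B_al^b, where
    B_al^b = (rho^i_al H_i^b) o phi_L ([Gamma_TphiH_hframe]), and the vertical
    frame section of index a to the vertical section with components
    H^ab o phi_L ([Gamma_TphiH_vframe]).  The brackets of the frame
    sections have no vertical part, so by the Leibniz rule the vertical part of
    the bracket of two such images is the difference of the derivatives of
    their vertical components along the two anchors; [ver_pbrk_hh], [ver_pbrk_hv] and [ver_pbrk_vv] write it out.

    On the other side stands the image of the bracket of the frame sections.
    For two horizontal sections this bracket is L^ga_{al be} times the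
    horizontal frame, whose image has the vertical components
    (L^ga_{al be} rho^k_ga H_k^b) o phi_L: this is the second identity.  For a
    horizontal and a vertical section, or two vertical ones, the bracket
    vanishes, and so does its image ([Gamma_TphiH_eq0]): these are the third
    and fourth identities.  The first identity, the horizontal part of the
    equation for two horizontal sections, says that both projections agree
    along phi_L; it holds because phi_L covers the identity of M. *)

Lemma smooth_at_cst (R : realType) (V W : normedModType R) (k : W) (q : V) :
  smooth_at (cst k) q.
Proof.
(* All iterated derivatives of a constant are again constants. *)
have iter_cst ds : exists k', iter_dir (cst k : V -> W) ds = cst k'.
  elim: ds => [|v ds [k' /= ->]]; first by exists k.
  by exists 0; apply/funext => z; exact: derive_cst.
apply: nearW => z ds; have [k' ->] := iter_cst ds.
exact: differentiable_cst.
Qed.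

(** Frame sections have components given by a Kronecker delta; this collapses
    the sums over frame indices in anchors and in the images of sections. *)
Lemma sum_delta (R : pzRingType) (I : finType) (j : I) (f : I -> R) :
  \sum_i (i == j)%:R * f i = f j.
Proof.
rewrite (bigD1 j)//= eqxx mul1r big1 ?addr0// => i /negbTE ->.
exact: mul0r.
Qed.

Section Anchor.
Context (R : realType) (m p r : nat) (M N : manifold R m).
Context (h : diffeo M N) (eta : diffeo N M).
Variables (A : gen_lie_algebroid h eta p) (E : vbundle M r).
Variables (c : chart R M m) (s : frame E r) (t : frame A p).
Implicit Types (f : tot E -> R) (V W : 'I_r -> tot E -> R).

Lemma panchor_hunit al V f u :
  panchor c s t (PSection (fun be _ => (be == al)%:R) V) f u =
  \sum_(i < m) rho_comp c t i al (h (tag u)) * dx c s i f u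
  + \sum_(a < r) V a u * dy c s a f u.
Proof. by rewrite /panchor /= sum_delta. Qed.

Lemma panchor_vertical V f u :
  panchor c s t (PSection (fun _ _ => 0) V) f u =
  \sum_(a < r) V a u * dy c s a f u.
Proof. by rewrite /panchor /= big1 ?add0r// => al _; rewrite mul0r. Qed.

(** The images of the frame sections have one of the two shapes Hsec and Vsec. *)
Local Notation Hsec al V := (PSection (fun be _ => (be == al)%:R) V).
Local Notation Vsec V := (PSection (fun _ _ => 0) V).
Local Notation rho i al u := (rho_comp c t i al (h (tag u))).

Lemma ver_pbrk_hh Ls al be V W b u :
  ver (pbrk c s t Ls (Hsec al V) (Hsec be W)) b u =
  \sum_(i < m) rho i al u * dx c s i (W b) u
  - \sum_(i < m) rho i be u * dx c s i (V b) u
  + \sum_(d < r) V d u * dy c s d (W b) u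
  - \sum_(d < r) W d u * dy c s d (V b) u.
Proof. by rewrite /= !panchor_hunit opprD addrACA addrA. Qed.

Lemma ver_pbrk_hv Ls al V W b u :
  ver (pbrk c s t Ls (Hsec al V) (Vsec W)) b u =
  \sum_(i < m) rho i al u * dx c s i (W b) u
  + \sum_(d < r) V d u * dy c s d (W b) u
  - \sum_(d < r) W d u * dy c s d (V b) u.
Proof. by rewrite /= panchor_hunit panchor_vertical. Qed.

Lemma ver_pbrk_vv Ls V W b u :
  ver (pbrk c s t Ls (Vsec V) (Vsec W)) b u =
  \sum_(d < r) V d u * dy c s d (W b) u
  - \sum_(d < r) W d u * dy c s d (V b) u.
Proof. by rewrite /= !panchor_vertical. Qed.

Lemma smooth_hframe al : smooth_psection c s t (hframe E al).
Proof. by move=> u _; split=> ?; exact: smooth_at_cst. Qed.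

Lemma smooth_vframe a : smooth_psection c s t (vframe p E a).
Proof. by move=> u _; split=> ?; exact: smooth_at_cst. Qed.

End Anchor.

Section FrameImages.
Context (R : realType) (m p r : nat) (M N : manifold R m).
Context (h : diffeo M N) (eta : diffeo N M).
Variables (A : gen_lie_algebroid h eta p) (E : vbundle M r).
Variables (c : chart R M m) (s : frame E r) (t : frame A p).
Variables (L : tot E -> R) (H : tot (dual_bundle E) -> R).

Let phiL : tot E -> tot (dual_bundle E) := legendre_map c s L.
Let Gamma := Gamma_TphiH c s t L H.

Lemma Gamma_TphiH_hframe al :
  Gamma (hframe (dual_bundle E) al) =
  PSection (fun be _ => (be == al)%:R)
    (fun b => (fun v => \sum_(i < m) rho_comp c t i al (h (tag v)) *
        dx c (dual_frame s) i (dy c (dual_frame s) b H) v) \o phiL).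
Proof.
congr PSection; apply/funext => b; apply/funext => u /=.
rewrite [X in _ + X]big1 => [|a _]; last exact: mul0r.
rewrite addr0 -[RHS](sum_delta al (fun be => \sum_(i < m)
  rho_comp c t i be (h (tag (phiL u))) *
  dx c (dual_frame s) i (dy c (dual_frame s) b H) (phiL u))).
apply: eq_bigr => be _; rewrite mulr_sumr; apply: eq_bigr => i _.
by rewrite mulrA [in RHS](mulrC _%:R).
Qed.

Lemma Gamma_TphiH_vframe a :
  Gamma (vframe p (dual_bundle E) a) =
  PSection (fun _ _ => 0)
    (fun b => dy c (dual_frame s) a (dy c (dual_frame s) b H) \o phiL).
Proof.
congr PSection; apply/funext => b; apply/funext => u /=.
rewrite sum_delta big1 ?add0r// => al _.
by rewrite big1// => i _; rewrite mulr0 mul0r.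
Qed.

(** The action on sections is linear over functions, hence pointwise: a section
    that vanishes at phi_L(u) has an image that vanishes at u.  It applies to
    the vanishing brackets of frame sections. *)
Lemma Gamma_TphiH_eq0 (X : psection (dual_bundle E) p r) u :
  (forall al, hor X al (phiL u) = 0) -> (forall a, ver X a (phiL u) = 0) ->
  forall b, ver (Gamma X) b u = 0.
Proof.
move=> X0 V0 b /=; rewrite !big1 ?addr0// => [a _|al _].
  by rewrite -/phiL V0 mul0r.
by rewrite big1// => i _; rewrite -/phiL X0 mulr0 mul0r.
Qed.

End FrameImages.

Theorem theorem56 (R : realType) (m p r : nat) (M N : manifold R m)
    (h : diffeo M N) (eta : diffeo N M) (F : gen_lie_algebroid h eta p)
    (E : vbundle M r) (L : tot E -> R) (H : tot (dual_bundle E) -> R)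
    (hL : fundamental L) (hLreg : regular_yy L)
    (hH : fundamental H) (hHyy : regular_yy H) (hHxy : regular_xy H)
    (hLH : legendre_transform L H)
    (c : chart R M m) (hc : atlas M c)
    (s : frame E r) (hs : frames E s)
    (t : frame F p) (ht : frames F t)
    (Ls : 'I_p -> 'I_p -> 'I_p -> N -> R) (hLs : structure_functions t Ls)
    (hmor : lie_algebroid_morphism c s t Ls L H) :
  let phiL : tot E -> tot (dual_bundle E) := legendre_map c s L in
  let pr : tot E -> M := fun u => tag u in
  let pr' : tot (dual_bundle E) -> M := fun v => tag v in
  let Lh ga al be := Ls al be ga \o h in
  let rho i al := rho_comp c t i al \o h in
  let d_x i (f : tot E -> R) := dx c s i f in
  let d_y a (f : tot E -> R) := dy c s a f in
  let Hpp a b := dy c (dual_frame s) a (dy c (dual_frame s) b H) in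
  let Hxp i b := dx c (dual_frame s) i (dy c (dual_frame s) b H) in
  let B al b : tot E -> R :=
    (fun v => \sum_(i < m) rho i al (pr' v) * Hxp i b v) \o phiL in
  forall u : tot E, mdom c s t L H u ->
  [/\ (forall al be ga,
         ((Lh ga al be \o pr') \o phiL) u = (Lh ga al be \o pr) u),
      (forall al be b,
         ((fun v => \sum_(k < m)
             (\sum_(ga < p) Lh ga al be (pr' v) * rho k ga (pr' v)) * Hxp k b v)
          \o phiL) u =
         \sum_(i < m) rho i al (pr u) * d_x i (B be b) u
         - \sum_(j < m) rho j be (pr u) * d_x j (B al b) u
         + \sum_(d < r) B al d u * d_y d (B be b) u
         - \sum_(d < r) B be d u * d_y d (B al b) u),
      (forall al a b,
         0 = \sum_(i < m) rho i al (pr u) * d_x i (Hpp b a \o phiL) u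
             + \sum_(d < r) B al d u * d_y d (Hpp b a \o phiL) u
             - \sum_(d < r) (Hpp b d \o phiL) u * d_y d (B al a) u) &
      (forall a b d,
         0 = \sum_(e < r) (Hpp a e \o phiL) u * d_y e (Hpp b d \o phiL) u
             - \sum_(e < r) (Hpp b e \o phiL) u * d_y e (Hpp a d \o phiL) u)].
Proof.
move=> phiL pr pr' Lh rho d_x d_y Hpp Hxp B u uD.
pose s' : frame (dual_bundle E) r := dual_frame s.
have smh al : smooth_psection c s' t (hframe (dual_bundle E) al).
  exact: smooth_hframe.
have smv a : smooth_psection c s' t (vframe p (dual_bundle E) a).
  exact: smooth_vframe.
split=> [//|al be b|al a b|a b d].
- have [_ /(_ b)] := hmor _ _ (smh al) (smh be) u uD.
  rewrite !Gamma_TphiH_hframe ver_pbrk_hh => e.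
  have [Lhh Vhh] := pbrk_hh c s' t Ls al be (phiL u).
  (* The left-hand side is the image of the bracket of the frame sections;
     its vertical part contributes nothing, by [Vhh]. *)
  etransitivity; last exact: e.
  rewrite /= -/phiL [X in _ = _ + X]big1 => [|a _]; last first.
    by have /= -> := Vhh a; exact: mul0r.
  rewrite addr0 exchange_big; apply: eq_bigr => k _ /=.
  rewrite mulr_suml; apply: eq_bigr => ga _.
  by have /= -> := Lhh ga; rewrite [X in X * _]mulrC.
- have [_ /(_ a)] := hmor _ _ (smh al) (smv b) u uD.
  have [hor0 ver0] := pbrk_hv c s' t Ls al b (phiL u).
  rewrite (Gamma_TphiH_eq0 t H hor0 ver0 a).
  rewrite Gamma_TphiH_hframe Gamma_TphiH_vframe ver_pbrk_hv; exact.
- have [_ /(_ d)] := hmor _ _ (smv a) (smv b) u uD.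
  have [hor0 ver0] := pbrk_vv c s' t Ls a b (phiL u).
  rewrite (Gamma_TphiH_eq0 t H hor0 ver0 d).
  rewrite !Gamma_TphiH_vframe ver_pbrk_vv; exact.
Qed.
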